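(* Let $P_1,\dots,P_5$ be five generic points on the real (resp. complex) projective plane. Define $$Q_1=(P_3P_4)\cap(P_2P_5),\quad Q_2=(P_4P_5)\cap(P_3P_1),\quad Q_3=(P_5P_1)\cap(P_4P_2),$$ $$Q_4=(P_1P_2)\cap(P_5P_3),\quad Q_5=(P_2P_3)\cap(P_1P_4).$$ Then the points $(P_1P_2)\cap(Q_3Q_5)$, $(P_5P_1)\cap(Q_4Q_2)$, and $Q_1$ are collinear.
   Context: $(XY)$ denotes the line through two distinct points $X,Y$. ''Generic'' choices are choices belonging to a suitable Zariski dense subset of the appropriate configuration space; concretely, the assertion is that the conclusion holds for all choices in some nonempty Zariski open subset of the space of choices. *)

(* Defs.v *)
From mathcomp Require Import all_boot all_order all_algebra.
From mathcomp Require Import reals complex.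
From mathcomp Require Import mpoly.

Set Implicit Arguments.
Unset Strict Implicit.
Unset Printing Implicit Defensive.

Import GRing.Theory.
Local Open Scope ring_scope.

Section ProjectivePlane.
Variable K : fieldType.

Definition point : Type := {U : {vspace 'rV[K]_3} | \dim U == 1%N}.

Definition point_space (X : point) : {vspace 'rV[K]_3} := val X.
Coercion point_space : point >-> space.

(* Only meaningful as "the line (XY)" when X <> Y: otherwise it has dimension
   1. The predicate is_crossing below carries that hypothesis. *)
Definition line (X Y : point) : {vspace 'rV[K]_3} := (X + Y)%VS.

(* "(AB) and (CD) are well-defined distinct lines and X = (AB) \cap (CD)". *)
Definition is_crossing (A B C D X : point) : Prop :=
  [/\ A <> B, C <> D, line A B <> line C D
    & (X : {vspace 'rV[K]_3}) = (line A B :&: line C D)%VS].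

(* X, Y, Z are not required to be distinct. *)
Definition collinear (X Y Z : point) : Prop :=
  exists L : {vspace 'rV[K]_3},
    [/\ \dim L = 2%N, (X <= L)%VS, (Y <= L)%VS & (Z <= L)%VS].

End ProjectivePlane.

(* The Zariski topology on (P^2)^n. Its multihomogeneous coordinate ring is
   {mpoly K[n * 3]}, the variable number (mxvec_index i j) being the j-th
   homogeneous coordinate of the i-th point. *)
Section Zariski.
Variables (K : fieldType) (n : nat).

Definition multihomogeneous (f : {mpoly K[n * 3]}) : Prop :=
  exists d : 'I_n -> nat, forall m, m \in msupp f ->
    forall i : 'I_n, (\sum_(j < 3) m (mxvec_index i j))%N = d i.

Definition homogeneous_coords (P : 'I_n -> point K) (v : 'M[K]_(n, 3)) : Prop :=
  forall i, <[row i v]>%VS = P i.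

Definition vanishes_at (f : {mpoly K[n * 3]}) (P : 'I_n -> point K) : Prop :=
  forall v, homogeneous_coords P v -> f.@[mxvec v 0] = 0.

Definition zariski_closed (Z : ('I_n -> point K) -> Prop) : Prop :=
  exists S : {mpoly K[n * 3]} -> Prop,
    (forall f, S f -> multihomogeneous f) /\
    (forall P, Z P <-> forall f, S f -> vanishes_at f P).

Definition zariski_open (U : ('I_n -> point K) -> Prop) : Prop :=
  zariski_closed (fun P => ~ U P).

Definition holds_generically (C : ('I_n -> point K) -> Prop) : Prop :=
  exists U : ('I_n -> point K) -> Prop,
    [/\ zariski_open U, exists P, U P & forall P, U P -> C P].

End Zariski.

(* Main.v *)
Require Import Defs.
From mathcomp Require Import all_boot all_order all_algebra.
From mathcomp Require Import reals complex.
From mathcomp Require Import mpoly ring.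

Set Implicit Arguments.
Unset Strict Implicit.
Unset Printing Implicit Defensive.

Import GRing.Theory.
Local Open Scope ring_scope.

(** Five points no three of which are collinear satisfy the conclusion, and
    having no three collinear points is a nonempty Zariski open condition.

    For the geometric part, take [P1], [P2], [P5] as frame of reference and
    let [P3] and [P4] have coordinates (a1, a2, a5) and (b1, b2, b5).  Put
    u = a1 b5 - a5 b1, v = b1 a2 - a1 b2 and w = b2 a5.  The points in question
    lie on the three sides of the reference triangle:
      [(P1P2) /\ (Q3Q5)] = (u, w, 0),  [(P5P1) /\ (Q4Q2)] = (v, 0, w),
      [Q1] = (0, v, - u),
    and v (u, w, 0) - u (v, 0, w) = w (0, v, - u), which is the collinearity
    (an instance of Menelaus' theorem).  This is [pentagon_collinear].  Every
    nondegeneracy condition needed to form the points amounts to the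
    nonvanishing of a product of coordinates and 2 x 2 minors of the two
    coordinate vectors, and each of these is, up to sign and a factor
    det(P1, P2, P5), the determinant of three of the five points.

    For genericity, multiply the determinants of all triples of distinct points.
    This is a multihomogeneous polynomial, so its nonvanishing locus is open;
    in characteristic 0 the points (1 : i : i^2) of a conic belong to it by the
    Vandermonde formula.  This is [holds_in_general_position]. *)

(** * Brackets, crossings and collinearity *)

Section Incidence.
Variable K : fieldType.
Implicit Types (a b c d e x y z : 'rV[K]_3) (A B C D X Y Z : point K).

Definition bracket a b c : K := \det (\matrix_(i < 3) nth 0 [:: a; b; c] i).

Lemma bracketE a b c :
  bracket a b c = a 0 0 * (b 0 1 * c 0 2%:R - b 0 2%:R * c 0 1)
                - a 0 1 * (b 0 0 * c 0 2%:R - b 0 2%:R * c 0 0)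
                + a 0 2%:R * (b 0 0 * c 0 1 - b 0 1 * c 0 0).
Proof.
rewrite /bracket (expand_det_row _ 0) !big_ord_recl big_ord0 /cofactor.
rewrite !(expand_det_row _ 0) !big_ord_recl !big_ord0 /cofactor !det_mx11.
(* Indexing entries by numbers lets simplification evaluate the lifted
   ordinals that come from the cofactors. *)
have [f E] : exists f, forall (x : 'rV[K]_3) i, x 0 i = f x (val i).
  by exists (fun x k => x 0 (inord k)) => x i; rewrite inord_val.
rewrite !mxE /= !E /=.
ring.
Qed.

(** Cramer's rule, in a form that makes sense even when the bracket is zero. *)
Lemma cramer a b c x :
  bracket a b c *: x =
  bracket x b c *: a + bracket a x c *: b + bracket a b x *: c.
Proof.
apply/rowP => j; rewrite !mxE !bracketE.
have : j \in [:: 0; 1; 2%:R] by case: j => [[|[|[]]]].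
by rewrite !inE => /or3P[] /eqP ->; ring.
Qed.

Definition comb a b c (x y z : K) : 'rV[K]_3 := x *: a + y *: b + z *: c.

Lemma bracket_comb a b c (x1 y1 z1 x2 y2 z2 x3 y3 z3 : K) :
  bracket (comb a b c x1 y1 z1) (comb a b c x2 y2 z2) (comb a b c x3 y3 z3) =
  (x1 * (y2 * z3 - z2 * y3) - y1 * (x2 * z3 - z2 * x3)
     + z1 * (x2 * y3 - y2 * x3)) * bracket a b c.
Proof. by rewrite !bracketE !mxE; ring. Qed.

(** The nonvanishing of a bracket is read off from coordinates in a frame; the
    squares allow the determinant [r] to be given only up to sign. *)
Lemma bracket_comb_neq0 a b c (r x1 y1 z1 x2 y2 z2 x3 y3 z3 : K) :
  bracket a b c != 0 ->
  r ^+ 2 = (x1 * (y2 * z3 - z2 * y3) - y1 * (x2 * z3 - z2 * x3)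
              + z1 * (x2 * y3 - y2 * x3)) ^+ 2 ->
  (bracket (comb a b c x1 y1 z1) (comb a b c x2 y2 z2) (comb a b c x3 y3 z3)
     != 0) = (r != 0).
Proof.
move=> abc r2; rewrite bracket_comb mulf_eq0 (negbTE abc) orbF.
by rewrite -[_ == 0](expf_eq0 _ 2) -r2 expf_eq0.
Qed.

Lemma frame_coords a b c x :
  bracket a b c != 0 -> exists s t u : K, x = comb a b c s t u.
Proof.
move=> abc; pose D := bracket a b c.
exists (bracket x b c / D), (bracket a x c / D), (bracket a b x / D).
apply: (scalerI abc); rewrite cramer /comb !scalerDr !scalerA.
by rewrite ![_ * (_ / _)]mulrC !divfK.
Qed.

Lemma bracket_neq0_notin a b c :
  bracket a b c != 0 -> c \notin (<[a]> + <[b]>)%VS.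
Proof.
apply: contra => /memv_addP[_ /vlineP[s ->] [_ /vlineP[t ->] ->]].
by apply/eqP; rewrite bracketE !mxE; ring.
Qed.

Lemma bracket_neq0_neq A B a b c :
  A = <[a]>%VS :> {vspace _} -> B = <[b]>%VS :> {vspace _} ->
  bracket a b c != 0 -> A <> B.
Proof.
move=> defA defB abc AB.
have: b \in <[a]>%VS by rewrite -defA AB defB memv_line.
move/vlineP => [t bE]; case/eqP: abc.
by rewrite bE bracketE !mxE; ring.
Qed.

Lemma exists_point x : x != 0 -> exists X, X = <[x]>%VS :> {vspace _}.
Proof.
move=> x0; have dx : \dim <[x]>%VS == 1%N by rewrite dim_vline x0.
by exists (exist _ <[x]>%VS dx).
Qed.

Lemma dim_point X : \dim (X : {vspace _}) = 1%N.
Proof. exact/eqP/(valP X). Qed.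

Lemma dim_line A B : A <> B -> \dim (line A B) = 2.
Proof.
move=> AB; apply/eqP; rewrite eqn_leq.
have := (dimv_add_leqif A B).1; rewrite !dim_point => -> /=.
rewrite ltnNge; apply/negP => le1; apply: AB; apply: val_inj.
have eqL X : (X <= line A B)%VS -> X = line A B :> {vspace _}.
  by move=> XL; apply/eqP; rewrite eqEdim XL dim_point.
by rewrite [LHS]eqL ?addvSl // [RHS]eqL ?addvSr.
Qed.

(** To exhibit the intersection of two lines it is enough to give one vector
    [x] in two ways, as a combination of the points on either line.  That [c]
    is off the first line separates the lines, so they meet in dimension 1
    only, and [s != 0] makes [x] a nonzero vector. *)
Lemma crossing_exists A B C D a b c d e x (s t u v : K) :
  A = <[a]>%VS :> {vspace _} -> B = <[b]>%VS :> {vspace _} ->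
  C = <[c]>%VS :> {vspace _} -> D = <[d]>%VS :> {vspace _} ->
  bracket a b c != 0 -> bracket c d e != 0 ->
  s != 0 -> x = s *: a + t *: b -> x = u *: c + v *: d ->
  exists X, X = <[x]>%VS :> {vspace _} /\ is_crossing A B C D X.
Proof.
move=> defA defB defC defD abc cde s0 xab xcd.
have x0 : x != 0.
  apply: contraNneq abc => x0.
  have : bracket x b c = s * bracket a b c by rewrite xab !bracketE !mxE; ring.
  rewrite x0 bracketE !mxE => /esym/eqP; rewrite !mul0r !addr0 oppr0.
  by rewrite addr0 mulf_eq0 (negbTE s0).
have [X defX] := exists_point x0; exists X; split=> //.
have AB := bracket_neq0_neq defA defB abc.
have CD := bracket_neq0_neq defC defD cde.
have lineS (F G : point K) (f g : 'rV[K]_3) (k l : K) :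
    F = <[f]>%VS :> {vspace _} -> G = <[g]>%VS :> {vspace _} ->
    k *: f + l *: g \in line F G.
  by rewrite /line => -> ->; rewrite memv_add // memvZ // memv_line.
have CnAB : c \notin line A B by rewrite /line defA defB bracket_neq0_notin.
have cCD : c \in line C D.
  by rewrite /line defC; apply: subvP (addvSl _ _) _ (memv_line _).
split=> //; first by move=> E; rewrite E cCD in CnAB.
have XI : (X <= line A B :&: line C D)%VS.
  by rewrite defX -memvE memv_cap {1}xab xcd !lineS.
apply/eqP; rewrite eqEdim XI dim_point leqNgt /=.
apply: contra CnAB => I2.
have /eqP IE : (line A B :&: line C D == line C D)%VS.
  by rewrite eqEdim capvSr (dim_line CD).
by move: cCD; rewrite -IE memv_cap => /andP[].
Qed.

Lemma collinear_comb X Y Z x y z (r s t : K) :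
  X = <[x]>%VS :> {vspace _} -> Y = <[y]>%VS :> {vspace _} ->
  Z = <[z]>%VS :> {vspace _} -> X <> Y ->
  r != 0 -> r *: z = s *: x + t *: y -> collinear X Y Z.
Proof.
move=> defX defY defZ XY r0 rz; exists (line X Y).
rewrite dim_line // addvSl addvSr; split=> //.
rewrite defZ -memvE -[z](scalerK r0) rz memvZ //.
by rewrite /line defX defY memv_add // memvZ // memv_line.
Qed.

End Incidence.

(** * General position is generic *)

Section GeneralPosition.
Variables (K : fieldType) (n : nat).

(** Homogeneity in the coordinates of the [i]-th point alone: handling one point
    at a time keeps the degree a number, so that it can be summed along with
    the products it belongs to. *)
Definition has_degree_at (i : 'I_n) (d : nat) (f : {mpoly K[n * 3]}) : Prop :=
  forall m, m \in msupp f -> (\sum_(j < 3) m (mxvec_index i j))%N = d.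

Lemma has_degree_at0 i d : has_degree_at i d 0.
Proof. by move=> m; rewrite msupp0. Qed.

Lemma has_degree_at1 i : has_degree_at i 0 1.
Proof.
by move=> m; rewrite msupp1 inE => /eqP ->; apply: big1 => j _; rewrite mnm0E.
Qed.

Lemma has_degree_atD i d f g :
  has_degree_at i d f -> has_degree_at i d g -> has_degree_at i d (f + g).
Proof.
by move=> df dg m /msuppD_le; rewrite mem_cat => /orP[/df|/dg].
Qed.

Lemma has_degree_atM i d e f g :
  has_degree_at i d f -> has_degree_at i e g -> has_degree_at i (d + e) (f * g).
Proof.
move=> df dg m /msuppM_le /allpairsP[[m1 m2] /= [/df <- /dg <- ->]].
by rewrite -big_split; apply: eq_bigr => j _; rewrite mnmDE.
Qed.

Lemma has_degree_at_sign i d s f :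
  has_degree_at i d f -> has_degree_at i d ((-1) ^+ s * f).
Proof.
move=> df m; rewrite -signr_odd; case: (odd s); last by rewrite mul1r; apply: df.
by rewrite mulN1r (perm_mem (msuppN f)); apply: df.
Qed.

Lemma has_degree_atX i k j : has_degree_at i (k == i) 'X_(mxvec_index k j).
Proof.
move=> m; rewrite msuppX inE => /eqP ->.
under eq_bigr => l _ do rewrite mnm1E.
have inj (l : 'I_3) :
    (mxvec_index k j == mxvec_index i l) = (k == i) && (j == l).
  have [g gK _] := curry_mxvec_bij n 3.
  apply/eqP/andP => [eq_idx | [/eqP -> /eqP ->] //].
  have := gK (k, j) isT; rewrite /= eq_idx (gK (i, l) isT).
  by case=> -> ->.
under eq_bigr => l _ do rewrite inj.
case: (k == i) => /=; last by rewrite big1.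
by rewrite (bigD1 j) //= eqxx big1 // => l; rewrite eq_sym => /negbTE ->.
Qed.

Definition generic_coords : 'M[{mpoly K[n * 3]}]_(n, 3) :=
  \matrix_(i, j) 'X_(mxvec_index i j).

Definition general_position_poly : {mpoly K[n * 3]} :=
  \prod_(f : {ffun 'I_3 -> 'I_n} | injectiveb f) \det (rowsub f generic_coords).

Lemma general_position_poly_multihomogeneous :
  multihomogeneous general_position_poly.
Proof.
(* A determinant has degree one in each point selected by [f]. *)
exists (fun i => \sum_(f : {ffun 'I_3 -> 'I_n} | injectiveb f)
                   \sum_(k < 3) (f k == i))%N => m mF i.
move: m mF; rewrite -/(has_degree_at _ _ _).
apply: (big_ind2 (fun F d => has_degree_at i d F)) => [||f _].
- exact: has_degree_at1.
- by move=> F d G e; apply: has_degree_atM.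
rewrite /determinant; apply: (big_ind (has_degree_at i _)) => [||s _].
- exact: has_degree_at0.
- exact: has_degree_atD.
apply: has_degree_at_sign.
apply: (big_ind2 (fun F d => has_degree_at i d F)) => [||k _].
- exact: has_degree_at1.
- by move=> F d G e; apply: has_degree_atM.
by rewrite !mxE; apply: has_degree_atX.
Qed.

Lemma general_position_poly_eval (v : 'M[K]_(n, 3)) :
  general_position_poly.@[mxvec v 0] =
  \prod_(f : {ffun 'I_3 -> 'I_n} | injectiveb f) \det (rowsub f v).
Proof.
rewrite rmorph_prod; apply: eq_bigr => f _; rewrite -det_map_mx; congr (\det _).
by apply/matrixP => i j; rewrite !mxE /= mevalXU mxvecE.
Qed.

Lemma general_position_poly_neq0 (v : 'M[K]_(n, 3)) i j k :
  general_position_poly.@[mxvec v 0] != 0 -> uniq [:: i; j; k] ->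
  bracket (row i v) (row j v) (row k v) != 0.
Proof.
rewrite general_position_poly_eval => /prodf_neq0 nz ijk.
pose f := [ffun l : 'I_3 => tnth [tuple i; j; k] l].
have f_inj : injectiveb f.
  by apply/injectiveP => l l'; rewrite !ffunE => /(tuple_uniqP _ ijk).
have -> // : bracket (row i v) (row j v) (row k v) = \det (rowsub f v).
  congr (\det _); apply/matrixP => l c; rewrite !mxE ffunE.
  by case: l => [[|[|[|]]]] //= ?; rewrite mxE.
exact: nz.
Qed.

Hypothesis char0 : [pchar K] =i pred0.

Lemma natr_inj_pchar0 : injective (fun m => m%:R : K).
Proof.
have /pcharf0P natr_eq0 := char0.
move=> m p; wlog le_mp : m p / (m <= p)%N => [H E | E].
  by case/orP: (leq_total m p) => le; [|apply/esym]; apply: H.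
by apply/eqP; rewrite eqn_leq le_mp -subn_eq0 -natr_eq0 natrB // E subrr eqxx.
Qed.

(** The witness: minors of the matrix with rows (1, i, i^2) are Vandermonde
    determinants with distinct nodes. *)
Lemma moment_curve_general_position :
  general_position_poly.@[mxvec (\matrix_(i < n, j < 3) (i%:R : K) ^+ j) 0] != 0.
Proof.
rewrite general_position_poly_eval; apply/prodf_neq0 => f /injectiveP f_inj.
have -> : rowsub f (\matrix_(i < n, j < 3) (i%:R : K) ^+ j) =
          (Vandermonde 3 (\row_k (f k)%:R))^T.
  by apply/matrixP => k j; rewrite !mxE.
rewrite det_tr det_Vandermonde; apply/prodf_neq0 => i _; apply/prodf_neq0 => j ij.
rewrite !mxE subr_eq0; apply: contraTneq ij => Efij.
suff -> : i = j by rewrite ltnn.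
exact/f_inj/val_inj/esym/natr_inj_pchar0.
Qed.

(** It is enough to prove a generic statement for homogeneous coordinates all of
    whose brackets are nonzero. *)
Lemma holds_in_general_position (C : ('I_n -> point K) -> Prop) :
  (forall P v, homogeneous_coords P v ->
     (forall i j k, uniq [:: i; j; k] ->
        bracket (row i v) (row j v) (row k v) != 0) -> C P) ->
  holds_generically C.
Proof.
move=> HC; pose F := general_position_poly.
exists (fun P => exists2 v, homogeneous_coords P v & F.@[mxvec v 0] != 0); split.
- exists (eq F); split=> [_ <-|P].
    exact: general_position_poly_multihomogeneous.
  split=> [nU _ <- v vP | FP [v vP /eqP]]; last by case; apply: FP.
  by apply/eqP; apply: contraT => Fv; case: nU; exists v.
- pose v : 'M[K]_(n, 3) := \matrix_(i, j) (i%:R : K) ^+ j.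
  have v0 i : \dim <[row i v]> == 1%N.
    rewrite dim_vline; suff -> : row i v != 0 by [].
    apply/eqP => /rowP/(_ 0)/eqP.
    by rewrite !mxE expr0 oner_eq0.
  exists (fun i => exist _ <[row i v]>%VS (v0 i)); exists v => //.
  exact: moment_curve_general_position.
by move=> P [v vP Fv]; apply: (HC P v vP) => i j k; apply: general_position_poly_neq0.
Qed.

End GeneralPosition.

(** * The configuration in the frame of three of its points *)

Section Configuration.
Variable K : fieldType.

(** Each crossing is found by cancelling a coordinate: its representative is the
    combination of the two points on one line that also lies on the other. *)
Lemma pentagon_collinear (P1 P2 P3 P4 P5 : point K) (p1 p2 p5 : 'rV[K]_3)
    (a1 a2 a5 b1 b2 b5 : K) (c := comb p1 p2 p5) :
  P1 = <[(c 1 0 0)%R]>%VS :> {vspace _} ->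
  P2 = <[(c 0 1 0)%R]>%VS :> {vspace _} ->
  P5 = <[(c 0 0 1)%R]>%VS :> {vspace _} ->
  P3 = <[(c a1 a2 a5)%R]>%VS :> {vspace _} ->
  P4 = <[(c b1 b2 b5)%R]>%VS :> {vspace _} ->
  bracket p1 p2 p5 != 0 ->
  a1 != 0 -> a2 != 0 -> a5 != 0 -> b1 != 0 -> b2 != 0 -> b5 != 0 ->
  b1 * a2 - a1 * b2 != 0 -> a1 * b5 - a5 * b1 != 0 -> b2 * a5 - a2 * b5 != 0 ->
  exists Q1 Q2 Q3 Q4 Q5 : point K,
    [/\ is_crossing P3 P4 P2 P5 Q1,
        is_crossing P4 P5 P3 P1 Q2,
        is_crossing P5 P1 P4 P2 Q3,
        is_crossing P1 P2 P5 P3 Q4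
      & is_crossing P2 P3 P1 P4 Q5] /\
    exists X Y : point K,
      [/\ is_crossing P1 P2 Q3 Q5 X,
          is_crossing P5 P1 Q4 Q2 Y
        & collinear X Y Q1].
Proof.
move=> e1 e2 e5 e3 e4 D a1n a2n a5n b1n b2n b5n vn un tn.
have w0 : b2 * a5 != 0 by rewrite mulf_neq0.
have wa0 : b2 * a5 * a2 != 0 by rewrite mulf_neq0.
have wb0 : b2 * a5 * b5 != 0 by rewrite mulf_neq0.
have ww0 : b2 * a5 * (b2 * a5) != 0 by rewrite mulf_neq0.
have one0 : (1 : K) != 0 by rewrite oner_neq0.
pose q1 := c 0 (b1 * a2 - a1 * b2) (b1 * a5 - a1 * b5).
have [Q1 [eQ1 crQ1]] :
    exists Z : point K, Z = <[q1]>%VS :> {vspace _}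
      /\ is_crossing P3 P4 P2 P5 Z.
  apply: (crossing_exists e3 e4 e2 e5 (e := c a1 a2 a5)
            (s := b1) (t := - a1)
            (u := b1 * a2 - a1 * b2) (v := b1 * a5 - a1 * b5)) => //.
  - by rewrite (bracket_comb_neq0 (r := a1 * b5 - a5 * b1)) //; ring.
  - by rewrite (bracket_comb_neq0 (r := a1)) //; ring.
  1,2: by apply/rowP => j; rewrite !mxE; ring.
pose q2 := c (b1 * a2) (b2 * a2) (b2 * a5).
have [Q2 [eQ2 crQ2]] :
    exists Z : point K, Z = <[q2]>%VS :> {vspace _}
      /\ is_crossing P4 P5 P3 P1 Z.
  apply: (crossing_exists e4 e5 e3 e1 (e := c b1 b2 b5)
            (s := a2) (t := b2 * a5 - a2 * b5)
            (u := b2) (v := a2 * b1 - b2 * a1)) => //.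
  - by rewrite (bracket_comb_neq0 (r := b1 * a2 - a1 * b2)) //; ring.
  - by rewrite (bracket_comb_neq0 (r := b2 * a5 - a2 * b5)) //; ring.
  1,2: by apply/rowP => j; rewrite !mxE; ring.
pose q3 := c b1 0 b5.
have [Q3 [eQ3 crQ3]] :
    exists Z : point K, Z = <[q3]>%VS :> {vspace _}
      /\ is_crossing P5 P1 P4 P2 Z.
  apply: (crossing_exists e5 e1 e4 e2 (e := c 0 0 1)
            (s := b5) (t := b1)
            (u := 1) (v := - b2)) => //.
  - by rewrite (bracket_comb_neq0 (r := b2)) //; ring.
  - by rewrite (bracket_comb_neq0 (r := b1)) //; ring.
  1,2: by apply/rowP => j; rewrite !mxE; ring.
pose q4 := c a1 a2 0.
have [Q4 [eQ4 crQ4]] :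
    exists Z : point K, Z = <[q4]>%VS :> {vspace _}
      /\ is_crossing P1 P2 P5 P3 Z.
  apply: (crossing_exists e1 e2 e5 e3 (e := c 1 0 0)
            (s := a1) (t := a2)
            (u := - a5) (v := 1)) => //.
  - by rewrite (bracket_comb_neq0 (r := 1)) //; ring.
  - by rewrite (bracket_comb_neq0 (r := a2)) //; ring.
  1,2: by apply/rowP => j; rewrite !mxE; ring.
pose q5 := c (a1 * b5) (b2 * a5) (a5 * b5).
have [Q5 [eQ5 crQ5]] :
    exists Z : point K, Z = <[q5]>%VS :> {vspace _}
      /\ is_crossing P2 P3 P1 P4 Z.
  apply: (crossing_exists e2 e3 e1 e4 (e := c 0 1 0)
            (s := b2 * a5 - a2 * b5) (t := b5)
            (u := a1 * b5 - b1 * a5) (v := a5)) => //.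
  - by rewrite (bracket_comb_neq0 (r := a5)) //; ring.
  - by rewrite (bracket_comb_neq0 (r := b5)) //; ring.
  1,2: by apply/rowP => j; rewrite !mxE; ring.
exists Q1, Q2, Q3, Q4, Q5; split=> //.
pose x := c (a1 * b5 - a5 * b1) (b2 * a5) 0.
have [X [eX crX]] :
    exists Z : point K, Z = <[x]>%VS :> {vspace _}
      /\ is_crossing P1 P2 Q3 Q5 Z.
  apply: (crossing_exists e1 e2 eQ3 eQ5 (e := c 1 0 0)
            (s := a1 * b5 - a5 * b1) (t := b2 * a5)
            (u := - a5) (v := 1)) => //.
  - by rewrite (bracket_comb_neq0 (r := b5)) //; ring.
  - by rewrite (bracket_comb_neq0 (r := b2 * a5 * b5)) //; ring.
  1,2: by apply/rowP => j; rewrite !mxE; ring.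
pose y := c (b1 * a2 - a1 * b2) 0 (b2 * a5).
have [Y [eY crY]] :
    exists Z : point K, Z = <[y]>%VS :> {vspace _}
      /\ is_crossing P5 P1 Q4 Q2 Z.
  apply: (crossing_exists e5 e1 eQ4 eQ2 (e := c 1 0 0)
            (s := b2 * a5) (t := b1 * a2 - a1 * b2)
            (u := - b2) (v := 1)) => //.
  - by rewrite (bracket_comb_neq0 (r := a2)) //; ring.
  - by rewrite (bracket_comb_neq0 (r := b2 * a5 * a2)) //; ring.
  1,2: by apply/rowP => j; rewrite !mxE; ring.
exists X, Y; split=> //.
have XY : X <> Y.
  apply: (bracket_neq0_neq eX eY (c := c 1 0 0)).
  by rewrite (bracket_comb_neq0 (r := b2 * a5 * (b2 * a5))) //; ring.
apply: (collinear_comb eX eY eQ1 (s := b1 * a2 - a1 * b2)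
          (t := a5 * b1 - a1 * b5) XY w0).
(* This is v (u, w, 0) - u (v, 0, w) = w (0, v, - u). *)
by apply/rowP => j; rewrite !mxE; ring.
Qed.

End Configuration.

Theorem theorem4p11 (R : realType) :
  let claim := fun K : fieldType =>
    holds_generically (fun P : 'I_5 -> point K =>
      let P1 := P (inord 0) in let P2 := P (inord 1) in
      let P3 := P (inord 2) in let P4 := P (inord 3) in
      let P5 := P (inord 4) in
      exists Q1 Q2 Q3 Q4 Q5 : point K,
        [/\ is_crossing P3 P4 P2 P5 Q1,
            is_crossing P4 P5 P3 P1 Q2,
            is_crossing P5 P1 P4 P2 Q3,
            is_crossing P1 P2 P5 P3 Q4
          & is_crossing P2 P3 P1 P4 Q5] /\
        exists X Y : point K,
          [/\ is_crossing P1 P2 Q3 Q5 X,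
              is_crossing P5 P1 Q4 Q2 Y
            & collinear X Y Q1])
  in claim R /\ claim R[i]%C.
Proof.
move=> claim.
suff main (K : fieldType) : [pchar K] =i pred0 -> claim K.
  by split; apply: main; apply: Num.Theory.pchar_num.
move=> char0; apply: holds_in_general_position => // P v vP gp.
set p1 := row (inord 0) v; set p2 := row (inord 1) v.
set p3 := row (inord 2) v; set p4 := row (inord 3) v.
set p5 := row (inord 4) v.
have ne i j k : uniq [:: i; j; k] -> all (gtn 5) [:: i; j; k] ->
    bracket (row (inord i) v) (row (inord j) v) (row (inord k) v) != 0.
  move=> ijk /= /and4P[i5 j5 k5 _]; apply: gp.
  by move: ijk; rewrite /= !inE -!val_eqE /= !inordK.
have D : bracket p1 p2 p5 != 0 by apply: ne.
have [a1 [a2 [a5 p3E]]] := frame_coords p3 D.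
have [b1 [b2 [b5 p4E]]] := frame_coords p4 D.
have p1E : p1 = comb p1 p2 p5 1 0 0 by apply/rowP => j; rewrite !mxE; ring.
have p2E : p2 = comb p1 p2 p5 0 1 0 by apply/rowP => j; rewrite !mxE; ring.
have p5E : p5 = comb p1 p2 p5 0 0 1 by apply/rowP => j; rewrite !mxE; ring.
have eP i p : row i v = p -> P i = <[p]>%VS :> {vspace _}.
  by move=> <-; apply/esym/vP.
have coord_neq0 (r x1 y1 z1 x2 y2 z2 x3 y3 z3 : K) q1 q2 q3 :
    bracket q1 q2 q3 != 0 -> q1 = comb p1 p2 p5 x1 y1 z1 ->
    q2 = comb p1 p2 p5 x2 y2 z2 -> q3 = comb p1 p2 p5 x3 y3 z3 ->
    r ^+ 2 = (x1 * (y2 * z3 - z2 * y3) - y1 * (x2 * z3 - z2 * x3)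
                + z1 * (x2 * y3 - y2 * x3)) ^+ 2 -> r != 0.
  move=> + q1E q2E q3E r2.
  by rewrite q1E q2E q3E (bracket_comb_neq0 D r2).
(* The nine coordinates and minors are the brackets of the triples other than
   (P1, P2, P5). *)
apply: (pentagon_collinear (eP _ _ p1E) (eP _ _ p2E) (eP _ _ p5E)
          (eP _ _ p3E) (eP _ _ p4E) D).
- by apply: coord_neq0 (ne 2 1 4 isT isT) p3E p2E p5E _; ring.
- by apply: coord_neq0 (ne 0 2 4 isT isT) p1E p3E p5E _; ring.
- by apply: coord_neq0 (ne 0 1 2 isT isT) p1E p2E p3E _; ring.
- by apply: coord_neq0 (ne 3 1 4 isT isT) p4E p2E p5E _; ring.
- by apply: coord_neq0 (ne 0 3 4 isT isT) p1E p4E p5E _; ring.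
- by apply: coord_neq0 (ne 0 1 3 isT isT) p1E p2E p4E _; ring.
- by apply: coord_neq0 (ne 2 3 4 isT isT) p3E p4E p5E _; ring.
- by apply: coord_neq0 (ne 2 1 3 isT isT) p3E p2E p4E _; ring.
- by apply: coord_neq0 (ne 0 2 3 isT isT) p1E p3E p4E _; ring.
Qed.
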